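(* Let $n\ge2$, let $(a,b)$ be an open interval, let $\Lambda=(\lambda_i)_{i=1}^n\in(a,b)^n$ be a sequence of distinct points, and let $\lambda_0\in(a,b)$. For every $f\in C^{2n}(a,b)$, $$Kr(\lambda_0,\Lambda,f)=2n\int_{-\infty}^{\infty}C^{T}(t,\Lambda)\,K_n(t,f)\,C(t,\Lambda)\,J_{\lambda_0,\Lambda}(t)\,dt .$$
   Context: Functions $f$ are real-valued. Divided differences are defined recursively by $[\lambda]_f=f(\lambda)$ and $[\mu_1,\dots,\mu_m]_f=\frac{[\mu_1,\dots,\mu_{m-1}]_f-[\mu_2,\dots,\mu_m]_f}{\mu_1-\mu_m}$ for distinct points, and are extended by continuity to tuples with repeated points (possible when $f\in C^{m-1}$). The Kraus matrix is $Kr(\lambda_0,\Lambda,f)=([\lambda_i,\lambda_j,\lambda_0]_f)_{1\le i,j\le n}$. The Hankel matrix is $K_n(t,f)=\left(\frac{f^{(i+j)}(t)}{(i+j)!}\right)_{1\le i,j\le n}$. The $n\times n$ matrix $C(t,\Lambda)$ is defined by letting $C_{i,j}(t,\Lambda)$ be the coefficient of $y^{i-1}$ in the polynomial $g_{j}(t,y)=\prod_{k\ne j}(1+y(t-\lambda_k))$ in the variable $y$ (product over $1\le k\le n$, $k\neq j$); $C^T$ denotes its transpose. Put $p_\Lambda(z)=\prod_{i=1}^n(z-\lambda_i)$ and $T_{\lambda_0,\Lambda}(z,t)=-\frac{(z-t)^{2n-1}}{(z-\lambda_0)\,p_\Lambda(z)^2}$. The weight is $$J_{\lambda_0,\Lambda}(t)=\sum_{\mu\in\{\lambda_0,\lambda_1,\dots,\lambda_n\},\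 \mu<t}\operatorname{Res}_{z=\mu}T_{\lambda_0,\Lambda}(z,t),$$ where $\{\lambda_0,\dots,\lambda_n\}$ is regarded as a set, so that each pole is counted once (also when $\lambda_0$ equals some $\lambda_i$, $i\geq 1$). It vanishes outside $[\min_{0\le i\le n}\lambda_i,\max_{0\le i\le n}\lambda_i]\subset(a,b)$; the integrand is understood to be zero outside this interval. The integral of a matrix-valued function is taken entrywise. *)

(* Defs.v *)
From HB Require Import structures.
From mathcomp Require Import all_boot all_order all_algebra.
From mathcomp Require Import all_classical all_reals all_analysis.
From mathcomp.real_closed Require Import complex.

Set Implicit Arguments.
Unset Strict Implicit.
Unset Printing Implicit Defensive.

Import Order.TTheory GRing.Theory Num.Theory.
Import numFieldNormedType.Exports.

Local Open Scope classical_set_scope.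
Local Open Scope ring_scope.

(* The end points are extended reals, so the interval may be unbounded. *)
Definition open_itv (R : realType) (a b : \bar R) : set R :=
  [set x | (a < x%:E < b)%E].

(* [f] is a total function, but on the open interval its derivatives only
   depend on the restriction of [f] to that interval. *)
Definition Ck (R : realType) (a b : \bar R) (k : nat) (f : R -> R) : Prop :=
  (forall (i : nat) (x : R), (i < k)%N -> open_itv a b x ->
     derivable (derive1n i f) x 1) /\
  (forall x : R, open_itv a b x -> {for x, continuous (derive1n k f)}).

(* A tuple (mu_1, ..., mu_m.+1) is a row vector; [col' ord_max] drops its last
   entry and [col' ord0] its first one.  Only meaningful for distinct points. *)
Fixpoint divdiff_distinct (R : realType) (f : R -> R) (m : nat) :
    'rV[R]_m.+1 -> R :=
  match m with
  | 0 => fun mu => f (mu ord0 ord0)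
  | m'.+1 => fun mu =>
      (divdiff_distinct f (col' ord_max mu) - divdiff_distinct f (col' ord0 mu))
      / (mu ord0 ord0 - mu ord0 ord_max)
  end.

Definition distinct_entries (R : realType) (m : nat) (mu : 'rV[R]_m) : bool :=
  injectiveb (mu ord0).

(* At a tuple with repetitions, the limit is taken along tuples of distinct
   points. *)
Definition divdiff (R : realType) (f : R -> R) (m : nat) (mu : 'rV[R]_m.+1) :
    R :=
  if distinct_entries mu then divdiff_distinct f mu
  else lim (divdiff_distinct f nu @[nu --> within [set nu | distinct_entries nu]
                                                  (nbhs mu)]).

Definition row3 (R : realType) (x y z : R) : 'rV[R]_3 :=
  \row_(k < 3) [:: x; y; z]`_k.

Definition Kraus (R : realType) (n : nat) (l0 : R) (lam : 'I_n -> R)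
    (f : R -> R) : 'M[R]_n :=
  \matrix_(i < n, j < n) divdiff f (row3 (lam i) (lam j) l0).

(* Indices in ['I_n] start at 0, whence the shift by 2. *)
Definition Hankel (R : realType) (n : nat) (t : R) (f : R -> R) : 'M[R]_n :=
  \matrix_(i < n, j < n) (derive1n (i.+1 + j.+1) f t / ((i.+1 + j.+1)`!)%:R).

Definition gpoly (R : realType) (n : nat) (lam : 'I_n -> R) (t : R)
    (j : 'I_n) : {poly R} :=
  \prod_(k < n | k != j) (1 + (t - lam k) *: 'X).

Definition Cmx (R : realType) (n : nat) (t : R) (lam : 'I_n -> R) : 'M[R]_n :=
  \matrix_(i < n, j < n) (gpoly lam t j)`_i.

(* [c] is the residue of [T] at [z0] when, on a punctured neighbourhood of
   [z0], [T] is the sum of the principal part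
   \sum_(k < m.+1) alpha k / (z - z0) ^ k.+1  with  alpha 0 = c
   and of a function holomorphic at [z0].  This covers the isolated
   singularities that are removable or poles. *)
Definition is_residue (K : numFieldType) (T : K -> K) (z0 c : K) : Prop :=
  exists (m : nat) (alpha : nat -> K) (G : K -> K),
    [/\ alpha 0%N = c,
        \forall z \near z0, derivable G z 1
      & \forall z \near z0^',
          T z = \sum_(k < m.+1) alpha k / (z - z0) ^+ k.+1 + G z].

Definition Res (K : numFieldType) (T : K -> K) (z0 : K) : K :=
  xget 0 [set c | is_residue T z0 c].

Definition Tfun (K : numFieldType) (n : nat) (l0 : K) (lam : 'I_n -> K)
    (z t : K) : K :=
  - ((z - t) ^+ (2 * n - 1) /
     ((z - l0) * (\prod_(i < n) (z - lam i)) ^+ 2)).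

(* The residues are those of a function of the complex variable z; they are
   real since l0, the lam i and t are, so that taking the real part only serves
   to land in [R].  [undup] makes each pole count once. *)
Definition Jweight (R : realType) (n : nat) (l0 : R) (lam : 'I_n -> R)
    (t : R) : R :=
  complex.Re
    (\sum_(mu <- undup (l0 :: codom lam) | mu < t)
       Res (fun z : R[i] =>
              Tfun (real_complex R l0) (fun i => real_complex R (lam i))
                   z (real_complex R t))
           (real_complex R mu)).

Definition min_pt (R : realType) (n : nat) (l0 : R) (lam : 'I_n -> R) : R :=
  \big[Num.min/l0]_(i < n) lam i.

Definition max_pt (R : realType) (n : nat) (l0 : R) (lam : 'I_n -> R) : R :=
  \big[Num.max/l0]_(i < n) lam i.

Definition integrand (R : realType) (n : nat) (l0 : R) (lam : 'I_n -> R)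
    (f : R -> R) (t : R) : 'M[R]_n :=
  if min_pt l0 lam <= t <= max_pt l0 lam then
    Jweight l0 lam t *: ((Cmx t lam)^T *m Hankel n t f *m Cmx t lam)
  else 0.

Definition mx_integrable (R : realType) (n : nat) (F : R -> 'M[R]_n) : Prop :=
  forall i j : 'I_n,
    (@lebesgue_measure R).-integrable setT (fun t => (F t i j)%:E).

Definition mx_integral (R : realType) (n : nat) (F : R -> 'M[R]_n) : 'M[R]_n :=
  \matrix_(i < n, j < n) (\int[@lebesgue_measure R]_(t in setT) (F t i j)).

(* Main.v *)
Require Import Defs.
From mathcomp Require Import all_boot all_order all_algebra.
From mathcomp Require Import all_classical all_reals all_analysis.
From mathcomp.real_closed Require Import complex.
From mathcomp Require Import ring lra zify.

Set Implicit Arguments.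
Unset Strict Implicit.
Unset Printing Implicit Defensive.

Import Order.TTheory GRing.Theory Num.Theory.
Import numFieldNormedType.Exports.

Local Open Scope classical_set_scope.
Local Open Scope ring_scope.

(* By the residue theorem, L g = sum over the nodes mu of
   Res_{z = mu} g(z) / ((z - l0) p(z)^2), where p(z) = prod_i (z - lam i),
   vanishes on polynomials of degree < 2n, and J(t) is, up to sign, the
   truncation of L to the nodes mu < t applied to (z - t)^(2n-1).  So J / (2n-1)!
   is the Peano kernel of L.  For q = p^2 / ((z - lam i)(z - lam j)), a polynomial
   of degree 2n - 2, the (i, j) entry of C^T K_n C is (q f)^(2n) / (2n)! by the
   Leibniz rule, and 2n times the integral is L (q f) = [lam i, lam j, l0]_f.
   The residue L_mu at a pole mu of order m only sees polynomials modulo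
   (X - mu)^m, hence acts on Taylor polynomials, and the Peano formula is the
   fundamental theorem of calculus for t |-> L_mu (Taylor polynomial of q f at t),
   one node mu at a time. *)

(** * Residues of rational functions as functionals on polynomials *)

Section PolynomialTaylor.
Variable K : fieldType.
Implicit Types (p q : {poly K}) (c : K).

Lemma coef_comp_polyXaddC p c i :
  (p \Po ('X + c%:P))`_i = (p^`N(i)).[c].
Proof.
have H : p \Po ('X + c%:P) = \sum_(j < size p) (p^`N(j)).[c]%:P * 'X^j.
  rewrite /comp_poly addrC nderiv_taylor; last exact: commr_polyX.
  rewrite size_map_inj_poly ?polyC0 //; last exact: polyC_inj.
  by apply: eq_bigr => j _; rewrite nderivn_map horner_map.
rewrite H coef_sum; have [ip|ip] := ltnP i (size p).
  rewrite (bigD1 (Ordinal ip)) //= coefCM coefXn eqxx mulr1 big1 ?addr0 //.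
  move=> j /eqP ji; rewrite coefCM coefXn; case: eqP => [E|]; last by rewrite mulr0.
  by case: ji; apply: val_inj.
rewrite nderivn_poly0 // horner0 big1 // => j _.
rewrite coefCM coefXn; case: eqP => [E|]; last by rewrite mulr0.
by have := ltn_ord j; rewrite -E ltnNge ip.
Qed.

(** After translation by [c] the condition says that ['X^m] divides; translating back gives the
    claim. Congruences of Taylor polynomials are checked in this way below. *)
Lemma dvdp_XsubC_exp p c m :
  (forall i, (i < m)%N -> (p \Po ('X + c%:P))`_i = 0) ->
  ('X - c%:P) ^+ m %| p.
Proof.
move=> H; rewrite -(comp_polyXaddC_K p c) -[p \Po _](poly_take_drop m).
rewrite (_ : take_poly m _ = 0) ?add0r; last first.
  apply/polyP => i; rewrite coef_take_poly coef0.
  by case: ifP => // im; rewrite H.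
by rewrite comp_polyM comp_Xn_poly dvdp_mull.
Qed.

(** The degrees are at most [m.-1] and exactly [k], so only the product of the two top terms reaches
    degree [m.-1 + k]. *)
Lemma coef_mul_monic p q m k :
  (size p <= m)%N -> (0 < m)%N -> q \is monic -> size q = k.+1 ->
  (p * q)`_(m.-1 + k) = p`_m.-1.
Proof.
move=> sp m0 mq sq; rewrite coefM.
have im : (m.-1 < (m.-1 + k).+1)%N by rewrite ltnS leq_addr.
rewrite (bigD1 (Ordinal im)) //= addKn.
have -> : q`_k = 1 by move/monicP: mq; rewrite /lead_coef sq.
rewrite mulr1 big1 ?addr0 // => j /eqP jm.
have [mj|jm'] := ltnP m.-1 j.
  by rewrite [p`_j]nth_default ?mul0r // (leq_trans sp) //; move: mj; lia.
rewrite [q`__]nth_default ?mulr0 // sq.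
have jm'' : (j < m.-1)%N.
  rewrite ltn_neqAle jm' andbT; apply/eqP => E; apply: jm.
  by apply: val_inj.
by move: jm''; lia.
Qed.

Lemma coef_comp_polyXaddC_top p c m : (size p <= m)%N -> (0 < m)%N ->
  (p \Po ('X + c%:P))`_m.-1 = p`_m.-1.
Proof.
move=> sp m0; rewrite coef_comp_polyXaddC.
have s1 : (size (p^`N(m.-1)) <= 1)%N.
  apply/leq_sizeP => j j1; rewrite coef_nderivn nth_default ?mul0rn //.
  by rewrite (leq_trans sp) //; lia.
by rewrite (size1_polyC s1) hornerC coef_nderivn addn0 binn.
Qed.

End PolynomialTaylor.

Section ResidueFunctional.
Variables (K : fieldType) (s : seq K) (M : K -> nat).
Implicit Types (p q : {poly K}) (r : K).

Definition node_poly : {poly K} := \prod_(v <- s) ('X - v%:P) ^+ M v.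

Definition co_node_poly r : {poly K} :=
  \prod_(v <- s | v != r) ('X - v%:P) ^+ M v.

(* The polynomial A with deg A < M r such that
   p / node_poly - A / (X - r) ^ M r has no pole at r. *)
Definition pole_part r p : {poly K} :=
  (p * xget 0 [set u | ('X - r%:P) ^+ M r %| u * co_node_poly r - 1])
    %% ('X - r%:P) ^+ M r.

(* Residue at r of the rational function p / node_poly. *)
Definition polyres r p : K := (pole_part r p)`_(M r).-1.

Lemma node_polyE r : r \in s -> uniq s ->
  node_poly = ('X - r%:P) ^+ M r * co_node_poly r.
Proof. by move=> rs us; rewrite /node_poly (bigD1_seq r). Qed.

Lemma horner_co_node_poly r : (co_node_poly r).[r] != 0.
Proof.
rewrite horner_prod prodf_seq_neq0; apply/allP => v _; apply/implyP => vr.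
by rewrite horner_exp hornerXsubC expf_neq0 // subr_eq0 eq_sym.
Qed.

Lemma coprimep_co_node r m : coprimep (('X - r%:P) ^+ m) (co_node_poly r).
Proof.
apply: coprimep_expl; rewrite coprimep_sym coprimep_XsubC.
exact: horner_co_node_poly.
Qed.

(** [pole_part r p] is p u modulo ('X - r)^(M r), where u inverts [co_node_poly r] modulo the same
    power; multiplying by [co_node_poly r] gives back p. *)
Lemma dvdp_pole_part r p :
  ('X - r%:P) ^+ M r %| p - pole_part r p * co_node_poly r.
Proof.
set d := ('X - r%:P) ^+ M r; rewrite /pole_part -/d.
set u := xget _ _.
have du : d %| u * co_node_poly r - 1.
  rewrite /u; case: xgetP => [v _ //|H]; exfalso.
  (* The default value of [xget] is never taken: a Bezout relation supplies an inverse. *)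
  have /Bezout_eq1_coprimepP [[v w] /= vw] := coprimep_co_node r (M r).
  apply: (H w) => /=; rewrite -vw -/d opprD addrC -addrA addNr addr0.
  by rewrite -mulNr dvdp_mull.
move: (divp_eq (p * u) d); set a := _ %/ _; set b := _ %% _ => E.
have -> : p - b * co_node_poly r =
  a * co_node_poly r * d - p * (u * co_node_poly r - 1).
  have -> : b = p * u - a * d by rewrite E [a * d + b]addrC addrK.
  by ring.
by rewrite dvdp_sub ?dvdp_mull //.
Qed.

Lemma size_pole_part r p : (size (pole_part r p) <= M r)%N.
Proof.
rewrite -ltnS -(size_exp_XsubC (M r) r) ltn_modp.
by rewrite expf_neq0 // polyXsubC_eq0.
Qed.

Lemma polyresP r : scalar (polyres r).
Proof.
move=> c p q; rewrite /polyres /pole_part mulrDl modpD -scalerAl modpZl.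
by rewrite coefD coefZ.
Qed.

(** The numerator enters [pole_part] only through its class modulo ('X - r)^(M r). This is what lets
    a residue act on jets of functions. *)
Lemma eq_polyres r p q : ('X - r%:P) ^+ M r %| p - q ->
  polyres r p = polyres r q.
Proof.
move=> H; rewrite /polyres /pole_part; congr (polyseq _)`_ _.
apply: subr0_eq; rewrite -modpN -modpD -mulrBl; apply/eqP.
exact: dvdp_mulr.
Qed.

Hypotheses (us : uniq s) (M0 : {in s, forall r, (0 < M r)%N}).

Lemma dvdp_node_poly p :
  {in s, forall r, ('X - r%:P) ^+ M r %| p} -> node_poly %| p.
Proof.
rewrite /node_poly; elim: s us => [_ _|r s' IH /= /andP[rs us'] H].
  by rewrite big_nil dvd1p.
rewrite big_cons Gauss_dvdp.
  by rewrite H ?mem_head //= IH // => v vs; apply: H; rewrite inE vs orbT.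
apply: coprimep_expl; rewrite coprimep_sym coprimep_XsubC /root.
rewrite horner_prod prodf_seq_neq0; apply/allP => v vs /=.
rewrite horner_exp hornerXsubC expf_neq0 // subr_eq0; apply: contra rs.
by move/eqP->.
Qed.

Lemma size_node_poly : size node_poly = (\sum_(r <- s) M r).+1.
Proof.
rewrite /node_poly size_prod_seq; last first.
  by move=> i _; rewrite expf_neq0 // polyXsubC_eq0.
under eq_bigr do rewrite size_exp_XsubC -addn1.
by rewrite big_split /= sum1_size -addSn addnK.
Qed.

(** Algebraic form of the residue theorem, the right-hand side being the contribution of infinity.
    In the partial fraction decomposition of p / [node_poly], each summand
    [pole_part r p * co_node_poly r] has the residue at r as its coefficient in the top degree. *)
Lemma sum_polyres p : (size p <= \sum_(r <- s) M r)%N ->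
  \sum_(r <- s) polyres r p = p`_(\sum_(r <- s) M r).-1.
Proof.
set d := (\sum_(r <- s) M r)%N => sp.
have nz v : co_node_poly v != 0.
  by apply/eqP => E; have := horner_co_node_poly v; rewrite E horner0 eqxx.
have mD r : co_node_poly r \is monic.
  by apply: monic_prod => v _; rewrite monic_exp ?monicXsubC.
have sD r : r \in s -> size (co_node_poly r) = (d - M r).+1.
  move=> rs; have := size_node_poly; rewrite (node_polyE rs us) -/d.
  rewrite size_Mmonic ?monic_exp ?monicXsubC ?expf_neq0 ?polyXsubC_eq0 //.
  move: (nz r); rewrite -size_poly_gt0 size_exp_XsubC => ? ?; lia.
have Md r : r \in s -> (M r <= d)%N.
  by move=> rs; rewrite /d (bigD1_seq r) //= leq_addr.
(* The difference is divisible by [node_poly] and has smaller degree, hence vanishes. *)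
have E : p = \sum_(r <- s) pole_part r p * co_node_poly r.
  apply/eqP; rewrite -subr_eq0; set q := _ - _.
  have Hq : node_poly %| q.
    apply: dvdp_node_poly => r rs; rewrite /q (bigD1_seq r) //= opprD addrA.
    rewrite dvdp_sub ?dvdp_pole_part //.
    apply: (big_ind (dvdp (('X - r%:P) ^+ M r))) => [|? ?|v vr].
    - exact: dvdp0.
    - exact: dvdp_add.
    apply: dvdp_mull.
    by rewrite /co_node_poly -big_filter (bigD1_seq r) ?dvdp_mulr //
       ?filter_uniq // mem_filter eq_sym vr.
  apply: contraT => q0.
  have := dvdp_leq q0 Hq; rewrite size_node_poly -/d leqNgt ltnS.
  suff -> : (size q <= d)%N by [].
  rewrite (leq_trans (size_polyD _ _)) // size_polyN geq_max sp /=.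
  apply: (leq_trans (size_sum _ _ _)); apply/bigmax_leqP_seq => r rs _.
  rewrite (leq_trans (size_polyMleq _ _)) // (sD _ rs).
  by have := size_pole_part r p; have := Md _ rs; lia.
rewrite [in RHS]E coef_sum !big_seq; apply: eq_bigr => r rs.
rewrite /polyres -(coef_mul_monic (size_pole_part r p) (M0 rs) (mD r) (sD _ rs)).
by congr (_ `_ _); have := Md _ rs; have := M0 rs; lia.
Qed.
End ResidueFunctional.

(** * Residues over a numeric field *)

Section Residues.
Variable K : numFieldType.
Implicit Types (p q : {poly K}) (z c : K).

Lemma numField_derivable_horner p z : derivable (horner p : K -> K) z 1.
Proof.
elim/poly_ind: p => [|p r IH].
  rewrite (_ : horner 0 = cst 0); first exact: derivable_cst.
  by apply/funext => y; rewrite horner0.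
rewrite (_ : horner _ = (horner p * id + cst r)); last first.
  by apply/funext => y; rewrite hornerMXaddC.
by apply: derivableD => //; apply: derivableM.
Qed.

Lemma numField_continuous_horner p z : {for z, continuous (horner p : K -> K)}.
Proof.
by apply/differentiable_continuous/derivable1_diffP/numField_derivable_horner.
Qed.

(** Multiplying by the highest power of z - z0 and letting z tend to z0 kills everything except the
    leading coefficient, which is therefore 0; induction removes the others. *)
Lemma principal_part_eq0 m (beta : nat -> K) (g : K -> K) z0 :
  {for z0, continuous g} ->
  (\forall z \near z0^', \sum_(k < m) beta k / (z - z0) ^+ k.+1 = g z) ->
  forall k, (k < m)%N -> beta k = 0.
Proof.
move=> cg; elim: m => [//|m IH] H.
have bm : beta m = 0.
  pose q := \sum_(k < m) beta k *: ('X - z0%:P) ^+ (m - k).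
  (* Away from z0 this equals [beta m], by the assumed identity; at z0 it is 0. *)
  pose h z := (('X - z0%:P) ^+ m.+1).[z] * g z - q.[z].
  have ch : {for z0, continuous h}.
    apply: continuousB; last exact: numField_continuous_horner.
    by apply: continuousM => //; exact: numField_continuous_horner.
  have h0 : h z0 = 0.
    rewrite /h horner_exp hornerXsubC subrr expr0n mul0r sub0r.
    rewrite horner_sum big1 ?oppr0 // => k _.
    rewrite hornerZ horner_exp hornerXsubC subrr expr0n.
    by have := ltn_ord k; case: (m - k)%N (subn_gt0 k m) => [<- //|j]; rewrite mulr0.
  have h1 : h z @[z --> z0^'] --> beta m.
    have c1 : cst (beta m) z @[z --> z0^'] --> beta m by exact: cvg_cst.
    apply: cvg_trans c1.
    apply: near_eq_cvg.
    near=> z.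
    have zz0 : z - z0 != 0.
      by rewrite subr_eq0; near: z; exact: nbhs_dnbhs_neq.
    have Hz : \sum_(k < m.+1) beta k / (z - z0) ^+ k.+1 = g z by near: z.
    suff -> : h z = beta m by [].
    rewrite /h -Hz big_ord_recr /= horner_exp hornerXsubC mulrDr.
    rewrite mulrCA divff ?expf_neq0 // mulr1 addrAC mulr_sumr horner_sum.
    rewrite [X in X + _ = _](_ : _ = 0) ?add0r //.
    apply/eqP; rewrite subr_eq0; apply/eqP; apply: eq_bigr => k _.
    rewrite hornerZ horner_exp hornerXsubC mulrCA; congr (_ * _).
    rewrite -[in LHS](@subnK k.+1 m.+1) ?ltnS 1?ltnW // exprD subSS.
    by rewrite mulfK // expf_neq0.
  have h2 : h z @[z --> z0^'] --> h z0.
    by apply: cvg_within_filter; exact: ch.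
  by rewrite (cvg_unique _ h1 h2) // h0.
move=> k; rewrite ltnS leq_eqVlt => /orP[/eqP -> //|km].
apply: IH => //; apply: filterS H => z; rewrite big_ord_recr /=.
by rewrite bm mul0r addr0.
Unshelve. all: by end_near. Qed.

(** The two principal parts are padded with zeros to a common length; their difference equals a
    function continuous at z0, so its coefficients vanish. *)
Lemma is_residue_unique (T : K -> K) z0 c c' :
  is_residue T z0 c -> is_residue T z0 c' -> c = c'.
Proof.
move=> [m [al [G [<- dG HT]]]] [m' [al' [G' [<- dG' HT']]]].
pose ext j (a : nat -> K) k := if (k < j.+1)%N then a k else 0.
have Hext j (a : nat -> K) z : (j <= maxn m m')%N ->
    \sum_(k < j.+1) a k / (z - z0) ^+ k.+1 =
    \sum_(k < (maxn m m').+1) ext j a k / (z - z0) ^+ k.+1.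
  move=> jm; rewrite (big_ord_widen (maxn m m').+1 (fun k => a k / (z - z0) ^+ k.+1)) //.
  rewrite big_mkcond /=; apply: eq_bigr => k _.
  by rewrite /ext; case: ifP => // _; rewrite mul0r.
have cont (F : K -> K) : (\forall z \near z0, derivable F z 1) ->
    {for z0, continuous F}.
  by move=> /nbhs_singleton H; apply/differentiable_continuous/derivable1_diffP.
have := @principal_part_eq0 (maxn m m').+1
  (fun k => ext m al k - ext m' al' k) (G' - G) z0 _ _ 0%N isT.
move=> /(_ _ _)/subr0_eq; apply.
  by apply: continuousB; exact: cont.
near=> z.
have H1 : T z = \sum_(k < m.+1) al k / (z - z0) ^+ k.+1 + G z by near: z.
have H2 : T z = \sum_(k < m'.+1) al' k / (z - z0) ^+ k.+1 + G' z by near: z.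
under eq_bigr do rewrite mulrBl.
rewrite big_split sumrN -!Hext ?leq_maxl ?leq_maxr //=.
apply/eqP; rewrite subr_eq addrAC -subr_eq opprK -H1 addrC -H2.
by [].
Unshelve. all: by end_near. Qed.

Lemma Res_val (T : K -> K) z0 c : is_residue T z0 c -> Res T z0 = c.
Proof.
move=> H; rewrite /Res; case: xgetP => [x _ Hx|/(_ c)//].
exact: is_residue_unique Hx H.
Qed.

(** The quotient is a / ('X - z0)^m + q / d, and q / d is holomorphic at z0. The principal part
    comes from expanding a in powers of z - z0, and translation does not change its coefficient of
    degree [m.-1]. *)
Lemma is_residue_rational p (a : {poly K}) q (d : {poly K}) z0 m :
  (0 < m)%N -> (size a <= m)%N -> d.[z0] != 0 -> p = a * d + ('X - z0%:P) ^+ m * q ->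
  is_residue (fun z => p.[z] / (('X - z0%:P) ^+ m * d).[z]) z0 a`_m.-1.
Proof.
move=> m0 sa d0 pE.
exists m.-1, (fun k => (a \Po ('X + z0%:P))`_(m.-1 - k)).
exists (fun z => q.[z] / d.[z]).
have dn0 : \forall z \near z0, d.[z] != 0.
  exact: (cvgr_neq0 _ (numField_continuous_horner (p := d) (z := z0)) d0).
split.
- by rewrite subn0 coef_comp_polyXaddC_top.
- near=> z; apply: derivableM; first exact: numField_derivable_horner.
  apply: derivableV; last exact: numField_derivable_horner.
  by near: z.
near=> z.
have dz : d.[z] != 0.
  by near: z; exact: (nbhs_dnbhs dn0).
have zz0 : z - z0 != 0.
  by rewrite subr_eq0; near: z; exact: nbhs_dnbhs_neq.
have az : a.[z] = \sum_(j < m) (a \Po ('X + z0%:P))`_j * (z - z0) ^+ j.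
  rewrite -{1}[a](comp_polyXaddC_K a z0) horner_comp hornerXsubC.
  by apply: horner_coef_wide; rewrite size_comp_poly2 ?size_XaddC.
rewrite pE hornerD !hornerM !horner_exp hornerXsubC.
have e : (z - z0) ^+ m != 0 by rewrite expf_neq0.
have -> : (a.[z] * d.[z] + (z - z0) ^+ m * q.[z]) / ((z - z0) ^+ m * d.[z]) =
   a.[z] / (z - z0) ^+ m + q.[z] / d.[z] by field; rewrite e dz.
congr (_ + _); rewrite az mulr_suml.
rewrite (reindex_inj rev_ord_inj) /= prednK //.
apply: eq_bigr => k _; rewrite -subn1 -subnDA add1n -mulrA; congr (_ * _).
have km := ltn_ord k.
rewrite -[in X in _ / X](@subnK k.+1 m) // exprD invfM mulrA divff ?mul1r //.
by rewrite expf_neq0.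
Unshelve. all: by end_near. Qed.

End Residues.

(** * The poles, their orders, and the weight as a sum of algebraic residues *)

Section Nodes.
Variables (R : realType) (n : nat) (l0 : R) (lam : 'I_n -> R).
Hypothesis lam_inj : injective lam.

Definition nodes : seq R := undup (l0 :: codom lam).

(** For injective [lam], the order of the pole of 1 / ((z - l0) p(z)^2) at [r]; it is 3 where [l0]
    meets some [lam i]. *)
Definition node_mult (r : R) : nat := ((r == l0) + 2 * (r \in codom lam))%N.

Lemma nodes_uniq : uniq nodes. Proof. exact: undup_uniq. Qed.

Lemma mem_nodes r : (r \in nodes) = (r == l0) || (r \in codom lam).
Proof. by rewrite mem_undup inE. Qed.

Lemma node_mult_gt0 : {in nodes, forall r, (0 < node_mult r)%N}.
Proof. by move=> r; rewrite mem_nodes /node_mult; do 2 case: (_ \in _) || case: eqP. Qed.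

Lemma node_poly_nodes :
  node_poly nodes node_mult =
  ('X - l0%:P) * (\prod_(i < n) ('X - (lam i)%:P)) ^+ 2.
Proof.
rewrite /node_poly /node_mult.
under eq_bigr do rewrite exprD mulnC exprM.
rewrite big_split /= prodrXl; congr (_ * _ ^+ 2).
  rewrite (bigD1_seq l0) ?nodes_uniq ?mem_nodes ?eqxx //= expr1 big1 ?mulr1 //.
  by move=> r /negPf ->; rewrite expr0.
transitivity (\prod_(r <- codom lam) ('X - r%:P)).
  rewrite (eq_bigr (fun r => if r \in codom lam then 'X - r%:P else 1)).
    rewrite -big_mkcond -big_filter; apply: perm_big; apply: uniq_perm.
    - by rewrite filter_uniq ?nodes_uniq.
    - by rewrite map_inj_uniq ?enum_uniq.
    by move=> r; rewrite mem_filter mem_nodes; case: (r \in _); rewrite ?orbT.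
  by move=> r _; case: (r \in _); rewrite ?expr0 ?expr1.
by rewrite big_map big_enum.
Qed.

Lemma sum_node_mult : (\sum_(r <- nodes) node_mult r = (2 * n).+1)%N.
Proof.
apply: succn_inj; rewrite -size_node_poly node_poly_nodes.
rewrite size_Mmonic ?polyXsubC_eq0 ?monic_exp ?monic_prod_XsubC // size_XsubC.
rewrite expr2 size_Mmonic ?monic_neq0 ?monic_prod_XsubC // -big_enum /=.
by rewrite size_prod_XsubC size_enum_ord; lia.
Qed.

(** All polynomials involved are real, so the decomposition of the numerator found over [R] is
    carried to [R[i]] by [real_complex] and read there as a principal part. The minus sign is that
    of [Tfun]. *)
Lemma Jweight_polyres t : Jweight l0 lam t =
  - \sum_(r <- nodes | r < t)
      polyres nodes node_mult r (('X - t%:P) ^+ (2 * n - 1)).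
Proof.
pose io := real_complex R.
rewrite /Jweight -/nodes.
have H r : r \in nodes ->
  Res (fun z : R[i] =>
    Tfun (real_complex R l0) (fun i => real_complex R (lam i)) z
      (real_complex R t)) (real_complex R r) =
  io (- polyres nodes node_mult r (('X - t%:P) ^+ (2 * n - 1))).
  move=> rs; apply: Res_val.
  set p := ('X - t%:P) ^+ (2 * n - 1).
  have /dvdpP [q qE] := dvdp_pole_part nodes node_mult r p.
  have pE : - p = - pole_part nodes node_mult r p * co_node_poly nodes node_mult r
      + ('X - r%:P) ^+ node_mult r * (- q).
    rewrite mulrN [_ * q]mulrC -qE; ring.
  have := @is_residue_rational _ (map_poly io (- p))
    (map_poly io (- pole_part nodes node_mult r p)) (map_poly io (- q))
    (map_poly io (co_node_poly nodes node_mult r)) (io r) (node_mult r)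
    (node_mult_gt0 rs).
  rewrite size_map_poly size_polyN size_pole_part => /(_ isT).
  rewrite horner_map fmorph_eq0 horner_co_node_poly => /(_ isT).
  rewrite {1}pE rmorphD !rmorphM rmorphXn /= rmorphB /= map_polyX map_polyC /=.
  move=> /(_ erefl); rewrite coef_map coefN /=.
  congr is_residue; apply/funext => z.
  have -> : ('X - (io r)%:P) ^+ node_mult r *
     map_poly io (co_node_poly nodes node_mult r) =
     map_poly io (node_poly nodes node_mult).
    by rewrite (node_polyE _ rs nodes_uniq) rmorphM rmorphXn /= rmorphB /=
      map_polyX map_polyC.
  rewrite node_poly_nodes /Tfun rmorphN rmorphM !rmorphXn rmorph_prod /=.
  rewrite !rmorphB /= !map_polyX !map_polyC hornerN hornerM !horner_exp.
  rewrite !hornerXsubC horner_prod mulNr; congr (- (_ / (_ * _ ^+ 2))).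
  by apply: eq_bigr => i _; rewrite rmorphB /= map_polyX map_polyC hornerXsubC.
rewrite big_seq_cond (eq_bigr (fun r => io
   (- polyres nodes node_mult r (('X - t%:P) ^+ (2 * n - 1))))).
  by rewrite -rmorph_sum /= -big_seq_cond sumrN.
by move=> r /andP[/H].
Qed.

End Nodes.

(** * Taylor jets and the Peano formula *)

Section TaylorJets.
Variables (R : realType) (a b : \bar R).
Implicit Types (A : nat -> R -> R) (L : {poly R} -> R) (q : {poly R}).

(* The normalisation A j = f^(j) / j! keeps factorials out of the Leibniz and
   Taylor formulas. *)
Definition taylor_jet (N : nat) A : Prop :=
  (forall j x, (j < N)%N -> open_itv a b x ->
     is_derive x 1 (A j) (j.+1%:R * A j.+1 x)) /\
  (forall x, open_itv a b x -> {for x, continuous (A N)}).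

Lemma Ck_taylor_jet N (f : R -> R) : Ck a b N f ->
  taylor_jet N (fun j x => derive1n j f x / j`!%:R).
Proof.
move=> [df cf]; split=> [j x jN xab|x xab]; last first.
  by apply: cvgMl; exact: cf.
have := df j x jN xab => /derivableP; rewrite -derive1E -derive1nS => H.
have := @is_deriveZ _ _ _ _ (j`!%:R^-1) x 1 _ H.
have -> : j`!%:R^-1 \*: derive1n j f = (fun x => derive1n j f x / j`!%:R).
  by apply/funext => y; rewrite /= /GRing.scale /= mulrC.
move=> H'; apply: is_derive_eq; rewrite /GRing.scale /= factS natrM.
by field; rewrite pnatr_eq0 -lt0n fact_gt0 addrC natr1 pnatr_eq0.
Qed.

Lemma taylor_jet_continuous N A k x : taylor_jet N A -> (k <= N)%N ->
  open_itv a b x -> {for x, continuous (A k)}.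
Proof.
move=> [dA cA]; rewrite leq_eqVlt => /orP[/eqP ->|kN] xab; first exact: cA.
have [dk _] := dA _ _ kN xab.
exact/differentiable_continuous/derivable1_diffP.
Qed.

(** Leibniz rule for (q f)^(m) / m!, where [A] is the normalised jet of f; [nderivn] already
    contains the division by the factorial. *)
Definition jet_mulp A q (m : nat) (x : R) : R :=
  \sum_(k < m.+1) A k x * (q^`N(m - k)).[x].

Lemma deriv_nderivn q m : (q^`N(m))^`() = q^`N(m.+1) *+ m.+1.
Proof.
apply/polyP => i; rewrite coef_deriv coefMn !coef_nderivn -!mulrnA addnS.
congr (_ *+ _); rewrite mulnC [in RHS]mulnC.
by have := mul_bin_left (m + i).+1 m; rewrite subSn ?leq_addr // addKn addSn.
Qed.

Lemma taylor_jet_mulp N A q : taylor_jet N A -> taylor_jet N (jet_mulp A q).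
Proof.
move=> jA; have [dA cA] := jA.
have jetE m : jet_mulp A q m =
    \sum_(k < m.+1) (A k * horner (q^`N(m - k))).
  by apply/funext => x; rewrite /jet_mulp fct_sumE.
split=> [m x mN xab|x xab]; last first.
  rewrite jetE; apply: (big_ind (fun g : R -> R => {for x, continuous g})) => [|? ?|k _].
  - exact: cst_continuous.
  - exact: continuousD.
  apply: continuousM.
    by apply: (taylor_jet_continuous jA) => //; rewrite -ltnS.
  exact: continuous_horner.
rewrite jetE.
have H (k : 'I_m.+1) : is_derive x 1 (A k * horner (q^`N(m - k)))
   (k.+1%:R * (A k.+1 x * (q^`N(m - k)).[x]) +
    (m - k).+1%:R * (A k x * (q^`N((m - k).+1)).[x])).
  have dk := dA k x (leq_ltn_trans (ltnSE (ltn_ord k)) mN) xab.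
  apply: is_derive_eq; rewrite deriv_nderivn hornerMn -mulr_natl.
  by rewrite /GRing.scale /=; ring.
apply: is_derive_eq; rewrite big_split /= /jet_mulp.
(* Both halves are put on the index range of the next jet. The added boundary terms have weight 0,
   and the weights k and m + 1 - k add up to m + 1. *)
transitivity (\sum_(k < m.+2) (k%:R * (A k x * (q^`N(m.+1 - k)).[x]) +
    (m.+1 - k)%:R * (A k x * (q^`N(m.+1 - k)).[x]))).
  rewrite big_split /=; congr (_ + _).
    rewrite [RHS]big_ord_recl mul0r add0r.
    by apply: eq_bigr => k _; rewrite lift0 subSS; ring.
  rewrite [RHS]big_ord_recr /= subnn mul0r addr0.
  by apply: eq_bigr => k _; rewrite subSn // -ltnS.
rewrite mulr_sumr; apply: eq_bigr => k _.
by rewrite -mulrDl -natrD subnKC // -ltnS.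
Qed.

Definition taylor_poly N A (t : R) : {poly R} :=
  \sum_(j < N) A j t *: ('X - t%:P) ^+ j.

Lemma size_taylor_poly N A t : (size (taylor_poly N A t) <= N)%N.
Proof.
apply: (leq_trans (size_sum _ _ _)); apply/bigmax_leqP => j _.
by rewrite (leq_trans (size_scale_leq _ _)) // size_exp_XsubC.
Qed.

Lemma taylor_poly_comp N A t :
  taylor_poly N A t \Po ('X + t%:P) = \poly_(j < N) A j t.
Proof.
rewrite /taylor_poly raddf_sum poly_def; apply: eq_bigr => j _ /=.
by rewrite comp_polyZ rmorphXn /= comp_polyB comp_polyX comp_polyC addrK.
Qed.

(** Around t, the coefficients of both sides below degree N are the same Cauchy product. *)
Lemma taylor_poly_mulp N A q t :
  ('X - t%:P) ^+ N %| taylor_poly N (jet_mulp A q) t - taylor_poly N A t * q.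
Proof.
apply: dvdp_XsubC_exp => i iN.
rewrite comp_polyB comp_polyM !taylor_poly_comp coefB coef_poly iN coefM.
apply/eqP; rewrite subr_eq0; apply/eqP/eq_bigr => k _.
by rewrite coef_poly (leq_ltn_trans _ iN) -1?ltnS // coef_comp_polyXaddC.
Qed.

(** [L] is a bare linear form, so the proof is an induction on [j] for all [L] at once: ('X -
    u)^(j+1) = 'X ('X - u)^j - u ('X - u)^j, and sending p to L ('X * p) is again linear. *)
Lemma is_derive_scalar_XsubC_exp L j (t : R) : scalar L ->
  is_derive t 1 (fun u : R => L (('X - u%:P) ^+ j))
    (- (j%:R * L (('X - t%:P) ^+ j.-1))).
Proof.
elim: j L => [|j IH] L Ls.
  rewrite mul0r oppr0; under eq_fun do rewrite expr0; exact: is_derive_cst.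
have LX : scalar (fun p => L ('X * p)).
  by move=> c p q'; rewrite mulrDr -scalerAr Ls.
have H1 := IH _ LX; have H2 := IH _ Ls.
have LZ c p : L (c *: p) = c * L p.
  have L0 : L 0 = 0 by have := Ls (-1) 0 0; rewrite scaleN1r addNr mulN1r addNr.
  by rewrite -[c *: p]addr0 Ls L0 addr0.
have LB p c q' : L (p - c *: q') = L p - c * L q'.
  by rewrite -scaleNr addrC Ls mulNr addrC.
have -> : (fun u : R => L (('X - u%:P) ^+ j.+1)) =
    (fun u : R => L ('X * ('X - u%:P) ^+ j)) - id * (fun u : R => L (('X - u%:P) ^+ j)).
  apply/funext => u; rewrite exprS mulrBl mul_polyC LB.
  by [].
apply: is_derive_eq; rewrite /GRing.scale /=.
case: j {IH H1 H2} => [|j]; first by rewrite !expr0 !mul0r !oppr0 mulr0 !add0r mulr1 mul1r.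
by rewrite /= [_ ^+ j.+1]exprS mulrBl mul_polyC LB -[in RHS]natr1; ring.
Qed.

(** The product rule gives a telescoping sum in which only the term with [A N] survives. *)
Lemma is_derive_taylor_poly N A L (t : R) : scalar L -> (0 < N)%N ->
  taylor_jet N A -> open_itv a b t ->
  is_derive t 1 (fun u : R => L (taylor_poly N A u))
    (N%:R * A N t * L (('X - t%:P) ^+ N.-1)).
Proof.
move=> Ls N0 [dA _] tab.
have LE u : L (taylor_poly N A u) = \sum_(j < N) A j u * L (('X - u%:P) ^+ j).
  have L0 : L 0 = 0 by have := Ls (-1) 0 0; rewrite scaleN1r addNr mulN1r addNr.
  rewrite /taylor_poly; elim/big_ind2: _ => // [? ? ? ? <- <-|j _].
    by rewrite -[X in L (X + _)]scale1r Ls mul1r.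
  by rewrite -[_ *: _]addr0 Ls L0 addr0.
have -> : (fun u : R => L (taylor_poly N A u)) =
    \sum_(j < N) (A j * (fun u : R => L (('X - u%:P) ^+ j))).
  by apply/funext => u; rewrite LE fct_sumE.
have H (j : 'I_N) : is_derive t 1 (A j * (fun u : R => L (('X - u%:P) ^+ j)))
   (j.+1%:R * A j.+1 t * L (('X - t%:P) ^+ j) -
    j%:R * A j t * L (('X - t%:P) ^+ j.-1)).
  have d1 := dA j t (ltn_ord j) tab.
  have d2 := is_derive_scalar_XsubC_exp j t Ls.
  by apply: is_derive_eq; rewrite /GRing.scale /=; ring.
apply: is_derive_eq.
pose F j := j%:R * A j t * L (('X - t%:P) ^+ j.-1).
rewrite -(big_mkord xpredT (fun j => F j.+1 - F j)) telescope_sumr //.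
by rewrite /F !mul0r subr0.
Qed.

Lemma Rintegral_taylor_poly N A L r B : scalar L -> (0 < N)%N ->
  taylor_jet N A -> open_itv a b r -> open_itv a b B -> r <= B ->
  let h t := N%:R * A N t * L (('X - t%:P) ^+ N.-1) in
  (@lebesgue_measure R).-integrable `[r, B] (EFin \o h) /\
  \int[@lebesgue_measure R]_(t in `[r, B]) h t =
    L (taylor_poly N A B) - L (taylor_poly N A r).
Proof.
move=> Ls N0 jA rab Bab rB h.
have sub x : x \in `[r, B] -> open_itv a b x.
  rewrite in_itv /= => /andP[rx xB]; rewrite /open_itv /=.
  case/andP: rab => ar _; case/andP: Bab => _ Bb.
  by rewrite (lt_le_trans ar) ?lee_fin // (le_lt_trans _ Bb) // lee_fin.
have dF x : open_itv a b x ->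
  is_derive x 1 (fun u : R => L (taylor_poly N A u)) (h x).
  by move=> xab; exact: is_derive_taylor_poly.
have cF x : open_itv a b x ->
    {for x, continuous (fun u : R => L (taylor_poly N A u))}.
  by move=> /dF [dx _]; exact/differentiable_continuous/derivable1_diffP.
have ch : {within `[r, B], continuous h}.
  apply: continuous_in_subspaceT => x /set_mem xrB.
  have xab := sub _ xrB.
  have [_ cA] := jA.
  apply: (@cvgM _ _ (nbhs x)).
    by apply: cvgM; [exact: cvg_cst|exact: cA].
  have [dx _] := is_derive_scalar_XsubC_exp N.-1 x Ls.
  exact/differentiable_continuous/derivable1_diffP.
have ih : (@lebesgue_measure R).-integrable `[r, B] (EFin \o h).
  by apply: continuous_compact_integrable => //; exact: segment_compact.
split => //.
move: rB; rewrite le_eqVlt => /orP[/eqP rB|rB].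
  by rewrite -rB set_itv1 Rintegral_set1 subrr.
rewrite /Rintegral (@continuous_FTC2 _ h (fun u : R => L (taylor_poly N A u))) //.
  split=> [x xrB||].
  - by have [] := dF x (sub _ (subset_itv_oo_cc xrB)).
  - by apply: cvg_at_right_filter; exact: cF.
  - by apply: cvg_at_left_filter; exact: cF.
move=> x xrB; rewrite derive1E.
by have [_ <-] := dF x (sub _ (subset_itv_oo_cc xrB)).
Qed.

End TaylorJets.

(** Exchanges the sum over the nodes below t with the integral over t. The node r contributes on the
    half-open interval from r to B, and adding the end point r changes no integral. *)
Lemma Rintegral_sum_itv (R : realType) (s : seq R) (h : R -> R -> R) (B : R) :
  let g t := \sum_(r <- s | r < t) (if t <= B then h r t else 0) in
  {in s, forall r,
    (@lebesgue_measure R).-integrable `[r, B] (EFin \o h r)} ->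
  (@lebesgue_measure R).-integrable setT (EFin \o g) /\
  \int[@lebesgue_measure R]_(t in setT) g t =
    \sum_(r <- s) \int[@lebesgue_measure R]_(t in `[r, B]) h r t.
Proof.
move=> g; rewrite {}/g; elim: s => [|r s IH] H.
  under eq_fun do rewrite big_nil.
  rewrite big_nil /Rintegral integral0; split=> //.
  exact: integrable0.
have [i2 e2] := IH (fun v vs => H v (mem_behead (s := r :: s) vs)).
have i1' : (@lebesgue_measure R).-integrable `]r, B] (EFin \o h r).
  by apply: (integrableS _ _ _ (H r (mem_head _ _))) => //;
    exact: subset_itv_oc_cc.
pose hr := h r \_ `]r, B].
have i1 : (@lebesgue_measure R).-integrable setT (EFin \o hr).
  by rewrite /hr -restrict_EFin; apply/integrable_restrict => //=; rewrite setTI.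
have gE t : \sum_(v <- r :: s | v < t) (if t <= B then h v t else 0) =
    hr t + \sum_(v <- s | v < t) (if t <= B then h v t else 0).
  rewrite big_cons /hr patchE mem_setE in_itv /=.
  by case: (r < t) => //=; rewrite ?add0r.
have -> : (fun t => \sum_(v <- r :: s | v < t) (if t <= B then h v t else 0)) =
   (fun t => hr t + \sum_(v <- s | v < t) (if t <= B then h v t else 0)).
  by apply/funext => t; exact: gE.
split; first exact: (integrableD _ i1 i2).
rewrite RintegralD // big_cons e2; congr (_ + _).
by rewrite /hr -Rintegral_mkcond Rintegral_itv_obnd_cbnd //; case/integrableP: i1'.
Qed.

(** * The matrix entries *)

Section HankelEntries.
Variables (R : realType) (n : nat) (lam : 'I_n -> R).

Definition lagrange_poly (i : 'I_n) : {poly R} :=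
  \prod_(k < n | k != i) ('X - (lam k)%:P).

Lemma lagrange_poly_monic i : lagrange_poly i \is monic.
Proof. by apply: monic_prod => k _; exact: monicXsubC. Qed.

Lemma size_lagrange_poly i : size (lagrange_poly i) = n.
Proof.
have : size (\prod_(k < n) ('X - (lam k)%:P)) = n.+1.
  by rewrite -big_enum /= size_prod_XsubC size_enum_ord.
rewrite (bigD1 i) //= -/(lagrange_poly i) size_monicM ?monicXsubC //.
  by rewrite size_XsubC => -[].
by rewrite monic_neq0 ?lagrange_poly_monic.
Qed.

(** Reversing the coefficients of a product reverses each factor, and 1 + c X is the reversal of X +
    c. [high] and [high'] bound the degrees by the number of factors. *)
Lemma coef_prod_rev (K : comNzRingType) (I : Type) (cs : seq I) (P : pred I)
    (c : I -> K) k : (k <= count P cs)%N ->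
  (\prod_(i <- cs | P i) (1 + c i *: 'X))`_k =
  (\prod_(i <- cs | P i) ('X + (c i)%:P))`_(count P cs - k).
Proof.
have high (s : seq I) j : (count P s < j)%N ->
   (\prod_(i <- s | P i) (1 + c i *: 'X))`_j = 0.
  elim: s j => [|x s IH] [|j] //= sj; first by rewrite big_nil coef1.
  rewrite big_cons; case: ifP sj => Px sj; last exact: IH.
  rewrite mulrDl mul1r -scalerAl coefD coefZ coefXM /=.
  by rewrite !IH ?mulr0 ?addr0 //; move: sj; lia.
have high' (s : seq I) j : (count P s < j)%N ->
   (\prod_(i <- s | P i) ('X + (c i)%:P))`_j = 0.
  elim: s j => [|x s IH] [|j] //= sj; first by rewrite big_nil coef1.
  rewrite big_cons; case: ifP sj => Px sj; last exact: IH.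
  rewrite mulrDl coefD coefCM coefXM /=.
  by rewrite !IH ?mulr0 ?addr0 //; move: sj; lia.
elim: cs k => [|x cs IH] k; first by rewrite !big_nil; case: k.
rewrite !big_cons /=; case: (P x); last exact: IH.
rewrite add1n => kn.
rewrite mulrDl mul1r -scalerAl coefD coefZ coefXM mulrDl coefD coefCM coefXM.
case: k kn => [|k] kn /=.
  by rewrite mulr0 !subn0 addr0 (high' _ (count P cs).+1) // mulr0 addr0 IH // subn0.
rewrite subSS; have [kn'|kn'|->] := ltngtP k (count P cs); last first.
- by rewrite subnn /= high // !add0r IH // subnn.
- by move: kn; rewrite ltnS leqNgt kn'.
have -> : (count P cs - k == 0)%N = false by move: kn'; lia.
by rewrite (IH _ kn') (IH _ (ltnW kn')) subnS.
Qed.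

(** [gpoly] has n - 1 factors and is the reversal of [lagrange_poly i] translated by t. *)
Lemma Cmx_coef t (i k : 'I_n) :
  Cmx t lam k i = (lagrange_poly i \Po ('X + t%:P))`_(n.-1 - k).
Proof.
have cn : count (fun j : 'I_n => j != i) (index_enum 'I_n) = n.-1.
  by rewrite -sum1_count sum1_card cardC1 card_ord.
rewrite mxE /gpoly coef_prod_rev; last first.
  by rewrite cn; have := ltn_ord k; lia.
rewrite cn /lagrange_poly rmorph_prod; congr (polyseq _)`_ _ => /=.
apply: eq_bigr => j _; rewrite comp_polyB comp_polyX comp_polyC polyCB.
by rewrite addrA.
Qed.

(** The polynomial p^2 / ((z - lam i)(z - lam j)), monic of degree 2n - 2. *)
Definition lagrange_poly2 i j := lagrange_poly i * lagrange_poly j.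

(** The Leibniz sum is a linear form in the translated product of the two Lagrange polynomials.
    Expanding both factors in monomials yields a double sum whose coefficients are entries of
    [Cmx]. *)
Lemma Hankel_entry (f : R -> R) t i j :
  ((Cmx t lam)^T *m Hankel n t f *m Cmx t lam) i j =
  jet_mulp (fun k x => derive1n k f x / k`!%:R) (lagrange_poly2 i j) (2 * n) t.
Proof.
pose A k := derive1n k f t / k`!%:R.
pose P i := lagrange_poly i \Po ('X + t%:P).
have sP u : (size (P u) <= n)%N.
  by rewrite size_comp_poly2 ?size_XaddC // size_lagrange_poly.
(* The form that sends X^m to [A (2 * n - m)]. *)
pose phi (p : {poly R}) := \sum_(k < (2 * n).+1) A k * p`_(2 * n - k).
have -> : jet_mulp (fun k x => derive1n k f x / k`!%:R) (lagrange_poly2 i j)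
    (2 * n) t = phi (P i * P j).
  apply: eq_bigr => k _; rewrite -coef_comp_polyXaddC.
  by rewrite /lagrange_poly2 rmorphM.
have phiD p q : phi (p + q) = phi p + phi q.
  by rewrite -big_split; apply: eq_bigr => k _; rewrite coefD mulrDr.
have phi0 : phi 0 = 0 by rewrite /phi big1 // => k _; rewrite coef0 mulr0.
have phiX c m : (m <= 2 * n)%N -> phi (c *: 'X^m) = c * A (2 * n - m)%N.
  move=> mn; have mn' : (2 * n - m < (2 * n).+1)%N by lia.
  rewrite /phi (bigD1 (Ordinal mn')) //= coefZ coefXn subKn // eqxx mulr1.
  rewrite mulrC big1 ?addr0 // => k /eqP km; rewrite coefZ coefXn.
  case: eqP => [E|]; last by rewrite !mulr0.
  by case: km; apply: val_inj => /=; have := ltn_ord k; lia.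
have PE u : P u = \sum_(k < n) (P u)`_k *: 'X^k.
  by rewrite -[LHS](take_poly_id (sP u)) /take_poly poly_def.
have phi_sum (F : 'I_n -> {poly R}) : phi (\sum_k F k) = \sum_k phi (F k).
  exact: (big_morph phi phiD phi0).
have XnM (c d : R) u v : (c *: 'X^u) * (d *: 'X^v) = (c * d) *: 'X^(u + v).
  by rewrite -scalerAl -scalerAr scalerA -exprD.
rewrite (PE i) (PE j) mulr_suml phi_sum.
rewrite (reindex_inj rev_ord_inj) /=.
rewrite mxE (eq_bigr (fun l : 'I_n => \sum_(k < n) Cmx t lam k i * A (k.+1 + l.+1)%N *
   Cmx t lam l j)); last first.
  by move=> l _; rewrite mxE mulr_suml; apply: eq_bigr => k _; rewrite !mxE.
rewrite exchange_big /=; apply: eq_bigr => k _.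
rewrite mulr_sumr phi_sum [RHS](reindex_inj rev_ord_inj) /=.
apply: eq_bigr => l _.
rewrite XnM phiX; last first.
  by have := ltn_ord k; have := ltn_ord l; lia.
rewrite !Cmx_coef -/(P i) -/(P j) mulrAC -!subn1 -!subnDA !add1n.
congr (_ * A _).
(* After reversal the degrees are n - 1 - k and n - 1 - l, and 2n minus their sum is the Hankel
   index k + l + 2. *)
by have := ltn_ord k; have := ltn_ord l; lia.
Qed.

Variable l0 : R.
Hypotheses (n2 : (2 <= n)%N) (lam_inj : injective lam).

Definition pts_mult (i j : 'I_n) (r : R) : nat :=
  ((r == lam i) + (r == lam j) + (r == l0))%N.

(** Handles [c = r] and [c != r] uniformly, so that coincidences among the three points need no case
    analysis. *)
Lemma XsubC_split (r c : R) : exists2 w : {poly R},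
  'X - c%:P = ('X - r%:P) ^+ (r == c) * w & w.[r] != 0.
Proof.
case: eqP => [->|/eqP rc]; first by exists 1; rewrite ?mulr1 // hornerC oner_eq0.
by exists ('X - c%:P); rewrite ?mul1r // hornerXsubC subr_eq0.
Qed.

Lemma node_poly_lagrange i j : node_poly (nodes l0 lam) (node_mult l0 lam) =
  lagrange_poly2 i j * (('X - (lam i)%:P) * ('X - (lam j)%:P) * ('X - l0%:P)).
Proof.
have H k : \prod_(u < n) ('X - (lam u)%:P) =
    ('X - (lam k)%:P) * lagrange_poly k by rewrite (bigD1 k).
rewrite node_poly_nodes // expr2 {1}(H i) (H j) /lagrange_poly2.
move: (lagrange_poly i) (lagrange_poly j) => p q; ring.
Qed.

(** [node_poly] is [lagrange_poly2 i j] times the three linear factors at [lam i], [lam j], [l0].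
    These contain ('X - r)^(pts_mult i j r) and a cofactor prime to 'X - r, which Gauss's lemma
    cancels. *)
Lemma dvdp_lagrange_pts i j r : r \in nodes l0 lam ->
  ('X - r%:P) ^+ node_mult l0 lam r %|
    lagrange_poly2 i j * ('X - r%:P) ^+ pts_mult i j r.
Proof.
move=> rs; have := node_poly_lagrange i j.
rewrite (node_polyE _ rs) ?nodes_uniq // => E.
have [wi Ei wi0] := XsubC_split r (lam i).
have [wj Ej wj0] := XsubC_split r (lam j).
have [w0 E0 w00] := XsubC_split r l0.
have co : coprimep (('X - r%:P) ^+ node_mult l0 lam r) (wi * wj * w0).
  apply: coprimep_expl; rewrite coprimep_sym coprimep_XsubC /root !hornerM.
  by rewrite !mulf_neq0.
rewrite -(Gauss_dvdpl _ co).
suff -> : lagrange_poly2 i j * ('X - r%:P) ^+ pts_mult i j r * (wi * wj * w0) =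
  ('X - r%:P) ^+ node_mult l0 lam r * co_node_poly (nodes l0 lam)
    (node_mult l0 lam) r by exact: dvdp_mulr.
by rewrite E Ei Ej E0 /pts_mult !exprD; ring.
Qed.

(** When the quadratic p interpolates f at the three points with multiplicity, q f and q p have the
    same residues, for q = [lagrange_poly2 i j]. The residues of q p sum to its coefficient of
    degree 2n, which is that of degree 2 in p since q is monic of degree 2n - 2. *)
Lemma sum_polyres_taylor_mulp i j (A : nat -> R -> R) (p : {poly R}) :
  (size p <= 3)%N ->
  {in nodes l0 lam, forall r,
    ('X - r%:P) ^+ pts_mult i j r %| taylor_poly (2 * n) A r - p} ->
  \sum_(r <- nodes l0 lam) polyres (nodes l0 lam) (node_mult l0 lam) r
    (taylor_poly (2 * n) (jet_mulp A (lagrange_poly2 i j)) r) = p`_2.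
Proof.
move=> sp H.
set q := lagrange_poly2 i j.
have mq : q \is monic by rewrite rpredM ?lagrange_poly_monic.
have sq : size q = (2 * n - 2).+1.
  rewrite size_Mmonic ?lagrange_poly_monic ?monic_neq0 ?lagrange_poly_monic //.
  by rewrite !size_lagrange_poly; lia.
rewrite (eq_big_seq (fun r =>
   polyres (nodes l0 lam) (node_mult l0 lam) r (p * q))).
  rewrite sum_polyres ?nodes_uniq ?sum_node_mult //; first last.
  - rewrite (leq_trans (size_polyMleq _ _)) // sq addnS /=.
    by apply: leq_trans (leq_add sp (leqnn _)) _; move: n2; lia.
  - exact: node_mult_gt0.
  rewrite /= -(coef_mul_monic sp _ mq sq) //.
  by congr (_ `_ _); lia.
move=> r rs; apply: eq_polyres.
(* The first difference is divisible by ('X - r)^(2n), and 2n exceeds every pole order, which is at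
   most 3. The second uses the interpolation at r. *)
have -> : taylor_poly (2 * n) (jet_mulp A q) r - p * q =
  (taylor_poly (2 * n) (jet_mulp A q) r - taylor_poly (2 * n) A r * q) +
  (taylor_poly (2 * n) A r - p) * q by ring.
rewrite dvdp_add //.
  apply: dvdp_trans (taylor_poly_mulp _ _ _ _).
  rewrite dvdp_exp2l // /node_mult.
  by case: (r == l0); case: (r \in codom lam); move: n2 => /=; lia.
have /dvdpP [u ->] := H r rs.
rewrite -mulrA [X in _ * X]mulrC dvdp_mull //.
exact: dvdp_lagrange_pts.
Qed.

End HankelEntries.

(** * Divided differences with repeated points *)

Section DividedDifferences.
Variables (R : realType) (a b : \bar R).
Implicit Types (f : R -> R) (A : nat -> R -> R).

Definition slope f (x y : R) : R := (f x - f y) / (x - y).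

Definition dd3 f (x y z : R) : R := (slope f x y - slope f y z) / (x - z).

Let i1 : 'I_3 := lift ord0 ord0.

Lemma divdiff_distinct3 f (nu : 'rV[R]_3) :
  divdiff_distinct f nu = dd3 f (nu ord0 ord0) (nu ord0 i1) (nu ord0 ord_max).
Proof.
rewrite /dd3 /slope /= !mxE.
have -> : lift ord_max (lift ord_max ord0) = ord0 :> 'I_3 by apply: val_inj.
have -> : lift ord_max (lift ord0 ord0) = i1 :> 'I_3 by apply: val_inj.
have -> : lift ord0 (lift ord_max ord0) = i1 :> 'I_3 by apply: val_inj.
have -> : lift ord0 (lift ord0 ord0) = ord_max :> 'I_3 by apply: val_inj.
have -> : lift ord_max ord0 = ord0 :> 'I_3 by apply: val_inj.
have -> : lift ord_max ord_max = i1 :> 'I_3 by apply: val_inj.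
by have -> : lift ord0 ord_max = ord_max :> 'I_3 by apply: val_inj.
Qed.

Lemma distinct_entries3 (nu : 'rV[R]_3) : distinct_entries nu =
  [&& nu ord0 ord0 != nu ord0 i1, nu ord0 i1 != nu ord0 ord_max
    & nu ord0 ord0 != nu ord0 ord_max].
Proof.
rewrite /distinct_entries; apply/injectiveP/and3P => [inj|[n01 n12 n02] i j].
  by split; apply/eqP => /inj /(congr1 val).
have cs (k : 'I_3) : [\/ k = ord0, k = i1 | k = ord_max].
  case: k => [[|[|[|k]]] Hk] //.
  - by constructor 1; apply: val_inj.
  - by constructor 2; apply: val_inj.
  - by constructor 3; apply: val_inj.
by case: (cs i) => ->; case: (cs j) => -> // /eqP;
  rewrite ?(negPf n01) ?(negPf n12) ?(negPf n02) // eq_sym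
    ?(negPf n01) ?(negPf n12) ?(negPf n02).
Qed.

Lemma row3E (x y z : R) : (row3 x y z ord0 ord0 = x) *
  (row3 x y z ord0 i1 = y) * (row3 x y z ord0 ord_max = z).
Proof. by rewrite /row3 !mxE. Qed.

(** Makes limits along distinct tuples unique. On the line mu + s (0, 1, 2), for small nonzero s,
    equal entries separate and different ones stay different. *)
Lemma within_distinct_proper (mu : 'rV[R]_3) :
  ProperFilter (within [set nu : 'rV[R]_3 | distinct_entries nu] (nbhs mu)).
Proof.
apply: Build_ProperFilter_ex.
move=> P HP.
pose g (s : R) : 'rV[R]_3 := mu + s *: (\row_(k < 3) k%:R).
have gE s k : g s ord0 k = mu ord0 k + s * k%:R by rewrite /g !mxE.
have cg : g s @[s --> (0 : R)^'] --> mu.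
  have : g s @[s --> (0 : R)^'] --> g 0.
    apply: cvg_within_filter.
    by apply: cvgD; [exact: cvg_cst|apply: cvgZr_tmp; exact: cvg_id].
  by rewrite {2}/g scale0r addr0.
have HP' : \forall s \near (0 : R)^', distinct_entries (g s) -> P (g s).
  exact: (cg _ HP).
have neq (k l : 'I_3) : k != l ->
    \forall s \near (0 : R)^', g s ord0 k != g s ord0 l.
  move=> kl; have [E|N] := eqVneq (mu ord0 k) (mu ord0 l).
    near=> s; rewrite !gE E (inj_eq (addrI _)).
    rewrite (inj_eq (mulfI _)) ?eqr_nat //.
    by near: s; exact: nbhs_dnbhs_neq.
  have N' : mu ord0 k - mu ord0 l != 0 by rewrite subr_eq0.
  have c : g s ord0 k - g s ord0 l @[s --> (0 : R)^'] -->
      mu ord0 k - mu ord0 l.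
    have ck i : g s ord0 i @[s --> (0 : R)^'] --> mu ord0 i.
      exact: (cvg_comp _ _ cg (@coord_continuous _ _ _ ord0 i mu)).
    exact: cvgB.
  by apply: filterS (cvgr_neq0 _ c N') => s; rewrite subr_eq0.
have n01 := neq ord0 i1 isT; have n12 := neq i1 ord_max isT.
have n02 := neq ord0 ord_max isT.
have [s [Ps s01 s12 s02]] : exists s, [/\ distinct_entries (g s) -> P (g s),
    g s ord0 ord0 != g s ord0 i1, g s ord0 i1 != g s ord0 ord_max
    & g s ord0 ord0 != g s ord0 ord_max].
  apply: (@filter_ex _ (0 : R)^').
  by near=> s; split; near: s.
by exists (g s); apply: Ps; rewrite distinct_entries3 s01 s12 s02.
Unshelve. all: by end_near. Qed.

Lemma divdiff_lim f (mu : 'rV[R]_3) c : ~~ distinct_entries mu ->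
  (dd3 f (nu ord0 ord0) (nu ord0 i1) (nu ord0 ord_max)
     @[nu --> within [set nu : 'rV[R]_3 | distinct_entries nu] (nbhs mu)] --> c) ->
  divdiff f mu = c.
Proof.
move=> /negPf ndis cv; rewrite /divdiff ndis.
have PF := within_distinct_proper mu.
apply: cvg_lim => //.
by under eq_fun do rewrite divdiff_distinct3.
Qed.

Lemma slopeC f x y : slope f x y = slope f y x.
Proof. by rewrite /slope -[x - y]opprB -[f x - f y]opprB invrN mulrNN. Qed.

Lemma dd3C12 f x y z : x != y -> y != z -> x != z ->
  dd3 f x y z = dd3 f y x z.
Proof.
move=> xy yz xz; rewrite /dd3 /slope; field.
by rewrite !subr_eq0 xy yz xz [y == x]eq_sym xy.
Qed.

Lemma dd3C23 f x y z : x != y -> y != z -> x != z ->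
  dd3 f x y z = dd3 f x z y.
Proof.
move=> xy yz xz; rewrite /dd3 /slope; field.
by rewrite !subr_eq0 xy yz xz [z == y]eq_sym yz.
Qed.

Lemma nbhs_open_itv u : open_itv a b u -> nbhs u (open_itv a b).
Proof.
case/andP=> au ub.
have Ha : \forall x \near u, (a < x%:E)%E.
  move: au; case: a => [a'||] //.
    rewrite lte_fin => au; have H : \forall x \near u, a' < x by exact: lt_nbhsr.
    by near=> x; rewrite lte_fin; near: x.
  by move=> _; near=> x; rewrite ltNyr.
have Hb : \forall x \near u, (x%:E < b)%E.
  move: ub; case: b => [b'||] //.
    rewrite lte_fin => ub; have H : \forall x \near u, x < b' by exact: lt_nbhsl.
    by near=> x; rewrite lte_fin; near: x.
  by move=> _; near=> x; rewrite ltry.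
by near=> x; apply/andP; split; near: x.
Unshelve. all: by end_near. Qed.

(** * Mean value theorems, limits at coalescing points, and Hermite interpolation *)

Variables (N : nat) (A : nat -> R -> R).
Hypotheses (N2 : (2 <= N)%N) (jA : taylor_jet a b N A).

Local Notation f := (A 0).

Lemma is_derive_jet_sub j (p : {poly R}) x : (j < N)%N -> open_itv a b x ->
  is_derive x 1 (fun t => A j t - p.[t]) (j.+1%:R * A j.+1 x - p^`().[x]).
Proof.
move=> jN xab; have [dA _] := jA; have dj := dA j x jN xab.
have := is_deriveB (f := A j) (g := horner p); exact.
Qed.

Lemma Rolle_jet j (p : {poly R}) x y : (j < N)%N -> x < y ->
  {in `[x, y], forall t, open_itv a b t} ->
  A j x = p.[x] -> A j y = p.[y] ->
  exists2 c, c \in `]x, y[ & j.+1%:R * A j.+1 c = p^`().[c].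
Proof.
move=> jN xy sub px py.
have [|||c cxy dc] := @Rolle R (fun t => A j t - p.[t]) x y xy.
- move=> t txy.
  by have [] := is_derive_jet_sub p jN (sub _ (subset_itv_oo_cc txy)).
- apply: continuous_in_subspaceT => t /set_mem txy.
  have [d _] := is_derive_jet_sub p jN (sub _ txy).
  exact/differentiable_continuous/derivable1_diffP.
- by rewrite px py !subrr.
exists c => //; apply: subr0_eq.
have [_ <-] := is_derive_jet_sub p jN (sub _ (subset_itv_oo_cc cxy)).
by have [_ <-] := dc.
Qed.

Lemma slope_mvt x y : x < y -> {in `[x, y], forall t, open_itv a b t} ->
  exists2 c, c \in `[x, y] & slope f x y = A 1 c.
Proof.
move=> xy sub.
pose p := (f x)%:P + slope f x y *: ('X - x%:P).
have [|||c cxy] := @Rolle_jet 0 p x y _ xy sub.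
- exact: ltnW.
- by rewrite /p !hornerE /= subrr mulr0 addr0.
- rewrite /p !hornerE /= /slope; field.
  by rewrite subr_eq0 lt_eqF.
rewrite mul1r /p !poly.derivE !hornerE /= => E; exists c.
  exact: subset_itv_oo_cc cxy.
by rewrite E; ring.
Qed.

Definition newton2 (c0 c1 c2 x y : R) : {poly R} :=
  c0%:P + c1 *: ('X - x%:P) + c2 *: (('X - x%:P) * ('X - y%:P)).

Lemma newton2E c0 c1 c2 x y r :
  (newton2 c0 c1 c2 x y).[r] = c0 + c1 * (r - x) + c2 * ((r - x) * (r - y)).
Proof. by rewrite /newton2 !hornerE. Qed.

Lemma deriv_newton2E c0 c1 c2 x y r :
  (newton2 c0 c1 c2 x y)^`().[r] = c1 + c2 * ((r - x) + (r - y)).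
Proof. by rewrite /newton2 !poly.derivE !hornerE /=; ring. Qed.

Lemma deriv2_newton2E c0 c1 c2 x y r :
  (newton2 c0 c1 c2 x y)^`()^`().[r] = 2%:R * c2.
Proof. by rewrite /newton2 !poly.derivE !hornerE /=; ring. Qed.

Lemma newton2_poly c0 c1 c2 x y : newton2 c0 c1 c2 x y =
  \poly_(k < 3) [:: c0 - c1 * x + c2 * x * y; c1 - c2 * (x + y); c2]`_k.
Proof.
rewrite poly_def !big_ord_recl big_ord0 /= /newton2 -!mul_polyC.
rewrite !(polyCD, polyCN, polyCM, rmorphD, rmorphB, rmorphM) /bump /=.
by rewrite expr0 expr1; ring.
Qed.

(** The Newton quadratic agrees with f at the three points, so two rounds of Rolle give a point
    where the second derivatives agree. The factor 2 disappears because [A 2] is f'' / 2. *)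
Lemma dd3_mvt_sorted x y z : x < y -> y < z ->
  {in `[x, z], forall t, open_itv a b t} ->
  exists2 c, c \in `[x, z] & dd3 f x y z = A 2 c.
Proof.
move=> xy yz sub; have xz := lt_trans xy yz.
pose p := newton2 (f x) (slope f x y) (dd3 f x y z) x y.
have px : f x = p.[x] by rewrite newton2E; ring.
have xy' : x - y != 0 by rewrite subr_eq0 lt_eqF.
have yz' : y - z != 0 by rewrite subr_eq0 lt_eqF.
have xz' : x - z != 0 by rewrite subr_eq0 lt_eqF.
have py : f y = p.[y] by rewrite newton2E /slope; field; rewrite xy'.
have pz : f z = p.[z].
  by rewrite newton2E /dd3 /slope; field; rewrite xy' yz' xz'.
have subx : {in `[x, y], forall t, open_itv a b t}.
  move=> t; rewrite in_itv /= => /andP[xt ty]; apply: sub.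
  by rewrite in_itv /= xt (le_trans ty) ?ltW.
have suby : {in `[y, z], forall t, open_itv a b t}.
  move=> t; rewrite in_itv /= => /andP[yt tz]; apply: sub.
  by rewrite in_itv /= tz (le_trans _ yt) ?ltW.
have N0 : (0 < N)%N by exact: ltnW.
have [c1 c1xy] := Rolle_jet N0 xy subx px py.
have [c2 c2yz] := Rolle_jet N0 yz suby py pz.
rewrite !mul1r => e2 e1.
move: c1xy c2yz; rewrite !in_itv /= => /andP[xc1 c1y] /andP[yc2 c2z].
have [|c] := Rolle_jet (N2 : (1 < N)%N) (lt_trans c1y yc2) _ e1 e2.
  move=> t; rewrite in_itv /= => /andP[c1t tc2]; apply: sub.
  by rewrite in_itv /= (le_trans (ltW xc1) c1t) (le_trans tc2 (ltW c2z)).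
rewrite in_itv /= => /andP[c1c cc2].
rewrite deriv2_newton2E => E; exists c.
  by rewrite in_itv /= ltW ?(lt_trans xc1) //= ltW ?(lt_trans cc2).
by apply: (@mulfI _ 2%:R); rewrite ?pnatr_eq0 // E.
Qed.


Lemma dd3_mvt x y z : x != y -> y != z -> x != z -> forall u v : R,
  {in `[u, v], forall t, open_itv a b t} ->
  x \in `[u, v] -> y \in `[u, v] -> z \in `[u, v] ->
  exists2 c, c \in `[u, v] & dd3 f x y z = A 2 c.
Proof.
move=> xy yz xz u v sub xuv yuv zuv.
have sorted p q r : p < q -> q < r -> p \in `[u, v] -> r \in `[u, v] ->
    exists2 c, c \in `[u, v] & dd3 f p q r = A 2 c.
  move=> pq qr; rewrite !in_itv /= => /andP[up _] /andP[_ rv].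
  have s t : t \in `[p, r] -> t \in `[u, v].
    by rewrite !in_itv /= => /andP[pt tr]; rewrite (le_trans up) ?(le_trans tr).
  have [c cpr ->] := dd3_mvt_sorted pq qr (fun t tpr => sub t (s t tpr)).
  by exists c => //; exact: s.
have yx : y != x by rewrite eq_sym.
have zy : z != y by rewrite eq_sym.
have zx : z != x by rewrite eq_sym.
(* Of the eight sign patterns two are cyclic, hence contradictory; the others are sorted by the
   symmetry of [dd3]. *)
case: (ltgtP x y) (xy) => // ltxy _; case: (ltgtP y z) (yz) => // ltyz _;
  case: (ltgtP x z) (xz) => // ltxz _.
- exact: sorted.
- by move: (lt_trans (lt_trans ltxy ltyz) ltxz); rewrite ltxx.
- by rewrite dd3C23 //; exact: sorted.
- by rewrite dd3C23 // dd3C12 //; exact: sorted.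
- by rewrite dd3C12 //; exact: sorted.
- by rewrite dd3C12 // dd3C23 //; exact: sorted.
- by move: (lt_trans (lt_trans ltyz ltxy) ltxz); rewrite ltxx.
- by rewrite dd3C12 // dd3C23 // dd3C12 //; exact: sorted.
Qed.

(** Turns a mean value theorem into a limit: the intermediate point is trapped in arbitrarily small
    intervals around u, where [A k] is continuous. *)
Lemma cvg_mean_value (T : Type) (G : set_system T) (FG : Filter G) k
    (g : T -> R) (u : R) : (k <= N)%N -> open_itv a b u ->
  (forall d, 0 < d -> {in `[u - d, u + d], forall t, open_itv a b t} ->
     \forall t \near G, exists2 c, c \in `[u - d, u + d] & g t = A k c) ->
  g t @[t --> G] --> A k u.
Proof.
move=> kN uab H; apply/cvgrPdist_lt => e e0.
have cA := taylor_jet_continuous jA kN uab.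
have : \forall c \near u, open_itv a b c /\ `|A k u - A k c| < e.
  have H1 := nbhs_open_itv uab.
  have H2 : \forall c \near u, `|A k u - A k c| < e.
    by move/cvgrPdist_lt : cA => /(_ e e0).
  by near=> c; split; near: c.
move=> /nbhs_ballP[d /= d0 sub].
have sub' c : c \in `[u - d / 2, u + d / 2] ->
    open_itv a b c /\ `|A k u - A k c| < e.
  rewrite in_itv /= => /andP[c1 c2]; apply: sub; rewrite /ball /= ltr_norml.
  by apply/andP; split; lra.
have d20 : 0 < d / 2 by lra.
have := H _ d20 (fun c cu => (sub' c cu).1).
by apply: filterS => t [c cd ->]; exact: (sub' c cd).2.
Unshelve. all: by end_near. Qed.

Lemma near_mem_itv (T : Type) (G : set_system T) (FG : Filter G)
    (x : T -> R) (u d : R) : 0 < d -> x t @[t --> G] --> u ->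
  \forall t \near G, x t \in `[u - d, u + d].
Proof.
move=> d0 /cvgrPdist_lt /(_ d d0); apply: filterS => t.
by rewrite ltr_norml in_itv /= => /andP[? ?]; apply/andP; split; lra.
Qed.

Lemma cvg_slope (T : Type) (G : set_system T) (FG : Filter G) (x y : T -> R)
    (u : R) : open_itv a b u -> x t @[t --> G] --> u -> y t @[t --> G] --> u ->
  (\forall t \near G, x t != y t) -> slope f (x t) (y t) @[t --> G] --> A 1 u.
Proof.
move=> uab xu yu xy; apply: cvg_mean_value => //; first exact: ltnW.
move=> d d0 sub; have xd := near_mem_itv FG d0 xu; have yd := near_mem_itv FG d0 yu.
have key p q : p < q -> p \in `[u - d, u + d] -> q \in `[u - d, u + d] ->
    exists2 c, c \in `[u - d, u + d] & slope f p q = A 1 c.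
  move=> pq; rewrite !in_itv /= => /andP[up _] /andP[_ qu].
  have s t : t \in `[p, q] -> t \in `[u - d, u + d].
    by rewrite !in_itv /= => /andP[pt tq]; rewrite (le_trans up) ?(le_trans tq).
  have [c cpq ->] := slope_mvt pq (fun t tpq => sub t (s t tpq)).
  by exists c => //; exact: s.
near=> t.
have xt : x t \in `[u - d, u + d] by near: t.
have yt : y t \in `[u - d, u + d] by near: t.
have : x t != y t by near: t.
case: ltgtP => // lt _; first exact: key.
by rewrite slopeC; exact: key.
Unshelve. all: by end_near. Qed.

Lemma cvg_dd3 (T : Type) (G : set_system T) (FG : Filter G) (x y z : T -> R)
    (u : R) : open_itv a b u -> x t @[t --> G] --> u -> y t @[t --> G] --> u ->
  z t @[t --> G] --> u ->
  (\forall t \near G, [&& x t != y t, y t != z t & x t != z t]) ->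
  dd3 f (x t) (y t) (z t) @[t --> G] --> A 2 u.
Proof.
move=> uab xu yu zu neq; apply: cvg_mean_value => // d d0 sub.
have xd := near_mem_itv FG d0 xu; have yd := near_mem_itv FG d0 yu.
have zd := near_mem_itv FG d0 zu.
near=> t.
have /and3P[xy yz xz] : [&& x t != y t, y t != z t & x t != z t] by near: t.
by apply: dd3_mvt => //; near: t.
Unshelve. all: by end_near. Qed.

Lemma cvg_dd3_double (T : Type) (G : set_system T) (FG : Filter G)
    (x y z : T -> R) (u w : R) : open_itv a b u -> open_itv a b w -> u != w ->
  x t @[t --> G] --> u -> y t @[t --> G] --> u -> z t @[t --> G] --> w ->
  (\forall t \near G, x t != y t) ->
  dd3 f (x t) (y t) (z t) @[t --> G] --> (A 1 u - slope f u w) / (u - w).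
Proof.
move=> uab wab uw xu yu zw xy.
have uw0 : u - w != 0 by rewrite subr_eq0.
have cf v (g : T -> R) : open_itv a b v -> g t @[t --> G] --> v ->
    f (g t) @[t --> G] --> f v.
  move=> vab gv; apply: continuous_cvg => //.
  exact: (taylor_jet_continuous jA (leq0n N) vab).
apply: cvgM; last by apply: cvgV => //; exact: cvgB.
apply: cvgB; first exact: cvg_slope.
apply: cvgM; last by apply: cvgV => //; exact: cvgB.
by apply: cvgB; exact: cf.
Qed.

(** In each coincidence pattern of the points, the limit defining [divdiff] is the leading
    coefficient of an explicit Newton quadratic that matches the jets. *)
Lemma hermite_interpolation x y z :
  open_itv a b x -> open_itv a b y -> open_itv a b z ->
  exists2 p : {poly R}, (size p <= 3)%N /\ p`_2 = divdiff f (row3 x y z) &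
    forall r i, (i < (r == x) + (r == y) + (r == z))%N -> p^`N(i).[r] = A i r.
Proof.
move=> xab yab zab.
suff [c0 [c1 [c2 [u [v [E H]]]]]] : exists c0 c1 c2 u v,
    c2 = divdiff f (row3 x y z) /\
    forall r, let m := ((r == x) + (r == y) + (r == z))%N in
    [/\ (0 < m)%N -> c0 + c1 * (r - u) + c2 * ((r - u) * (r - v)) = f r,
       (1 < m)%N -> c1 + c2 * ((r - u) + (r - v)) = A 1 r &
       (2 < m)%N -> c2 = A 2 r].
  exists (newton2 c0 c1 c2 u v).
    rewrite newton2_poly; split; first exact: size_poly.
    by rewrite coef_poly -E.
  move=> r i im; have [H0 H1 H2] := H r.
  case: i im => [|[|[|i]]] im.
  - by rewrite nderivn0 newton2E H0.
  - by rewrite nderivn1 deriv_newton2E H1.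
  - rewrite -H2 // newton2_poly.
    set p := \poly_(_ < _) _.
    have s1 : (size (p^`N(2)) <= 1)%N.
      apply/leq_sizeP => j j1; rewrite coef_nderivn nth_default ?mul0rn //.
      by rewrite (leq_trans (size_poly _ _)) // addnC addn2 !ltnS.
    by rewrite (size1_polyC s1) hornerC coef_nderivn coef_poly.
  - by exfalso; move: im; do 3 case: eqP => _.
have dist : distinct_entries (row3 x y z) = [&& x != y, y != z & x != z].
  by rewrite distinct_entries3 !row3E.
pose G (mu : 'rV[R]_3) := within [set nu : 'rV[R]_3 | distinct_entries nu] (nbhs mu).
have near_dist mu : G mu (fun nu : 'rV[R]_3 =>
   [&& nu ord0 ord0 != nu ord0 i1, nu ord0 i1 != nu ord0 ord_max
    & nu ord0 ord0 != nu ord0 ord_max]).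
  have FG : Filter (G mu) := within_filter _ _.
  apply: filterS (withinT _ _) => nu /=.
  by rewrite distinct_entries3.
have cc (mu : 'rV[R]_3) (k : 'I_3) (c : R) : mu ord0 k = c ->
    (fun nu : 'rV[R]_3 => nu ord0 k) @ G mu --> c.
  by move=> <-; apply: cvg_within_filter; exact: coord_continuous.
(* The patterns with [u] double and [w] simple: both Newton nodes are placed at [u], and the leading
   coefficient is fixed by the value at [w]. *)
have double u w : open_itv a b u -> open_itv a b w -> u != w ->
    (forall r, (r == x) + (r == y) + (r == z) = (r == u) * 2 + (r == w))%N ->
    divdiff f (row3 x y z) = (A 1 u - slope f u w) / (u - w) ->
    exists c0 c1 c2 u v, c2 = divdiff f (row3 x y z) /\
    forall r, let m := ((r == x) + (r == y) + (r == z))%N in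
    [/\ (0 < m)%N -> c0 + c1 * (r - u) + c2 * ((r - u) * (r - v)) = f r,
       (1 < m)%N -> c1 + c2 * ((r - u) + (r - v)) = A 1 r &
       (2 < m)%N -> c2 = A 2 r].
  move=> uab wab uw mE ->.
  exists (f u), (A 1 u), ((A 1 u - slope f u w) / (u - w)), u, u.
  split=> // r m; rewrite /m {m} mE.
  have [->|ru] := eqVneq r u; first by rewrite (negPf uw); split => // _; ring.
  have [->|rw] := eqVneq r w; split => //= _.
  by rewrite /slope; field; rewrite subr_eq0.
have [xy|xy] := eqVneq x y; [have [xz|xz] := eqVneq x z|].
- subst y z; exists (f x), (A 1 x), (A 2 x), x, x; split=> [|r m].
    apply/esym/divdiff_lim; first by rewrite dist eqxx.
    by apply: cvg_dd3 => //; try exact: near_dist; apply: cc; rewrite row3E.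
  by rewrite /m {m}; have [->|rx] := eqVneq r x; split => //= _; ring.
- subst y; apply: (double x z) => //; first by move=> r; rewrite addnn muln2.
  apply: divdiff_lim; first by rewrite dist eqxx.
  apply: cvg_dd3_double => //; try by apply: cc; rewrite row3E.
  by apply: filterS (near_dist _) => nu /and3P[].
have [yz|yz] := eqVneq y z.
  subst z; rewrite eq_sym in xy; apply: (double y x) => //.
    by move=> r; rewrite -addnA addnn muln2 addnC.
  apply: divdiff_lim; first by rewrite dist eqxx andbF.
  have FG : Filter (G (row3 x y y)) := within_filter _ _.
  (* The coalescing pair is moved to the first two places; symmetry at distinct points moves it
     back. *)
  have cv : dd3 f (nu ord0 i1) (nu ord0 ord_max) (nu ord0 ord0)
      @[nu --> G (row3 x y y)] --> (A 1 y - slope f y x) / (y - x).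
    apply: cvg_dd3_double => //; try by apply: cc; rewrite row3E.
    by apply: filterS (near_dist _) => nu /and3P[].
  apply: cvg_trans cv; apply: near_eq_cvg.
  apply: filterS (near_dist _) => nu /and3P[n01 n12 n02].
  by rewrite [RHS]dd3C12 // dd3C23 // eq_sym.
have [xz|xz] := eqVneq x z.
  subst z; apply: (double x y) => //.
    by move=> r; rewrite addnAC addnn muln2.
  apply: divdiff_lim; first by rewrite dist eqxx !andbF.
  have FG : Filter (G (row3 x y x)) := within_filter _ _.
  have cv : dd3 f (nu ord0 ord0) (nu ord0 ord_max) (nu ord0 i1)
      @[nu --> G (row3 x y x)] --> (A 1 x - slope f x y) / (x - y).
    apply: cvg_dd3_double => //; try by apply: cc; rewrite row3E.
    by apply: filterS (near_dist _) => nu /and3P[].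
  apply: cvg_trans cv; apply: near_eq_cvg.
  apply: filterS (near_dist _) => nu /and3P[n01 n12 n02].
  by rewrite [RHS]dd3C23.
exists (f x), (slope f x y), (dd3 f x y z), x, y; split.
  by rewrite /divdiff dist xy yz xz divdiff_distinct3 !row3E.
move=> r m; rewrite /m {m}.
have [->|rx] := eqVneq r x.
  by rewrite (negPf xy) (negPf xz); split => // _; ring.
have [->|ry] := eqVneq r y.
  rewrite (negPf yz); split => //= _.
  by rewrite /slope; field; rewrite subr_eq0.
have [->|rz] := eqVneq r z; split => //= _.
by rewrite /dd3 /slope; field; rewrite !subr_eq0 xy yz xz.
Qed.

End DividedDifferences.

(** * Position of the nodes and assembly of the integral formula, entry by entry *)

Lemma nodes_min_max (R : realType) (n : nat) (l0 : R) (lam : 'I_n -> R) r :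
  r \in nodes l0 lam -> min_pt l0 lam <= r <= max_pt l0 lam.
Proof.
rewrite mem_nodes => /orP[/eqP ->|/codomP[i ->]].
  by rewrite /min_pt /max_pt bigmin_le_id bigmax_ge_id.
by rewrite /min_pt /max_pt bigmin_le_cond //= le_bigmax.
Qed.

Lemma open_itv_max_pt (R : realType) (n : nat) (a b : \bar R) (l0 : R)
    (lam : 'I_n -> R) : open_itv a b l0 ->
  (forall i, open_itv a b (lam i)) -> open_itv a b (max_pt l0 lam).
Proof.
move=> l0ab lamab; rewrite /max_pt; elim/big_ind: _ => // x y xab yab.
by rewrite /Order.max; case: ifP.
Qed.

Theorem theorem23 (R : realType) (n : nat) (hn : (2 <= n)%N) (a b : \bar R)
    (lam : 'I_n -> R) (lam_inj : injective lam)
    (lam_ab : forall i : 'I_n, open_itv a b (lam i))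
    (l0 : R) (l0_ab : open_itv a b l0)
    (f : R -> R) (hf : Ck a b (2 * n) f) :
  mx_integrable (integrand l0 lam f) /\
  (Kraus l0 lam f = (2 * n)%:R *: mx_integral (integrand l0 lam f))%R.
Proof.
pose A := fun k x => derive1n k f x / k`!%:R.
have A0 : A 0%N = f by apply/funext => x; rewrite /A /= divr1.
have jA : taylor_jet a b (2 * n) A := Ck_taylor_jet hf.
have N0 : (0 < 2 * n)%N by move: hn; lia.
have N2 : (2 <= 2 * n)%N by move: hn; lia.
have n0 : (2 * n)%:R != 0 :> R by rewrite pnatr_eq0 -lt0n.
set B := max_pt l0 lam.
have Bab : open_itv a b B := open_itv_max_pt l0_ab lam_ab.
have nodes_ab r : r \in nodes l0 lam -> open_itv a b r.
  by rewrite mem_nodes => /orP[/eqP ->|/codomP[i ->]].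
pose L r := polyres (nodes l0 lam) (node_mult l0 lam) r.
have LP r : scalar (L r) := polyresP _ _ _.
pose E i j := jet_mulp A (lagrange_poly2 lam i j).
have jE i j : taylor_jet a b (2 * n) (E i j) := taylor_jet_mulp _ jA.
pose h i j r t := (2 * n)%:R * E i j (2 * n)%N t *
  L r (('X - t%:P) ^+ (2 * n).-1).
(* Undoes the factor 2n that differentiating the Taylor polynomial puts into [h]; the sign is that
   of the weight. *)
pose c : R := - (2 * n)%:R^-1.
pose g i j t := \sum_(r <- nodes l0 lam | r < t) (if t <= B then h i j r t else 0).
have gE i j : (fun t => integrand l0 lam f t i j) = (fun t => c * g i j t).
  apply/funext => t; rewrite /integrand /g.
  (* Left of the smallest point no node is below t and the sum is empty; right of [B] both sides are
     cut to 0. *)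
  have [tmin|tmin] := leP (min_pt l0 lam) t; last first.
    rewrite big_seq_cond big_pred0 ?mulr0 ?mxE // => r.
    apply/andP => -[/nodes_min_max/andP[minr _] rt].
    by have := lt_trans rt tmin; rewrite ltNge minr.
  have [tB|tB] /= := leP t B; last by rewrite big1 ?mulr0 ?mxE.
  rewrite mxE Hankel_entry Jweight_polyres // subn1.
  rewrite -/A -/(E i j) /h mulNr -mulr_sumr /c mulNr mulrA; congr (- _).
  by rewrite mulrA mulVf // mul1r mulrC.
have hI i j : {in nodes l0 lam, forall r,
    (@lebesgue_measure R).-integrable `[r, B] (EFin \o h i j r) /\
    \int[@lebesgue_measure R]_(t in `[r, B]) h i j r t =
    L r (taylor_poly (2 * n) (E i j) B) - L r (taylor_poly (2 * n) (E i j) r)}.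
  move=> r rs; apply: Rintegral_taylor_poly (nodes_ab _ rs) Bab _ => //.
  by have /andP[] := nodes_min_max rs.
have [gI gS] : (forall i j, (@lebesgue_measure R).-integrable setT (EFin \o g i j)) /\
    (forall i j, \int[@lebesgue_measure R]_(t in setT) g i j t =
       \sum_(r <- nodes l0 lam) \int[@lebesgue_measure R]_(t in `[r, B]) h i j r t).
  by split=> i j; have [] := @Rintegral_sum_itv _ (nodes l0 lam) (h i j) B
    (fun r rs => (hI i j r rs).1).
split.
  move=> i j.
  have -> : (fun t => (integrand l0 lam f t i j)%:E) =
      (fun t => c%:E * (EFin \o g i j) t)%E.
    apply/funext => t; have := congr1 (@^~ t) (gE i j) => /= ->.
    by rewrite EFinM.
  exact: integrableZl.
apply/matrixP => i j; rewrite !mxE gE RintegralZl // gS.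
rewrite -A0.
(* The Kraus entry becomes the leading coefficient of the interpolating quadratic. *)
have [p [sp <-] Hp] := hermite_interpolation N2 jA (lam_ab i) (lam_ab j) l0_ab.
rewrite (eq_big_seq _ (fun r rs => (hI i j r rs).2)) sumrB.
(* The terms at [B] are residues of one polynomial of degree below 2n, so their sum, its coefficient
   of degree 2n, is 0. *)
rewrite sum_polyres ?nodes_uniq ?sum_node_mult //=; last first.
- by rewrite (leq_trans (size_taylor_poly _ _ _)).
- exact: node_mult_gt0.
rewrite [X in X - _]nth_default ?size_taylor_poly // sub0r.
rewrite (@sum_polyres_taylor_mulp _ _ lam l0 hn lam_inj i j A p sp).
  by rewrite /c mulrNN mulrA mulfV // mul1r.
move=> r _; apply: dvdp_XsubC_exp => k km.
rewrite comp_polyB coefB taylor_poly_comp coef_poly coef_comp_polyXaddC Hp //.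
(* The multiplicity of a point is at most 3, so the Taylor polynomial reaches every order to be
   matched. *)
have -> : (k < 2 * n)%N.
  apply: leq_trans km _; rewrite /pts_mult.
  by do 3 case: eqP => _; move: hn => /=; lia.
by rewrite subrr.
Qed.
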